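(* Let $K$ be a group, let $(PQR): P\xrightarrow{\bar\jmath}Q\xrightarrow{\bar\phi}R$ be a group extension, let $\theta:Q\to\mathrm{Out}(K)$ be an outer action, and let $(KGQ)=(G,i,\pi)$ be an extension of $K$ by $Q$ with outer action $\theta$. Let $(KNP)=(N,i_0,\pi_0)$ be its $P$-subextension, $j:N\hookrightarrow G$ the canonical inclusion, so that $(KNGQR)=(G,j,\pi)$ is an iterated extension of $(KNP)$ by $(PQR)$, and let $\Theta:Q\to\mathrm{Out}(N;K)$ be its mod-$K$ outer action. Then the subgroup $\mathrm{Out}(KNGQR;K)\subseteq\mathrm{Out}(KGQ;K)$ is the kernel of the canonical homomorphism $$\mathrm{Out}(KGQ;K)\to\mathrm{Out}_\Theta(KNP;K)$$ induced by $\mathrm{Aut}(KGQ)\to\mathrm{Aut}(KNP)$, $\xi\mapsto\xi|_N$. In other words, if $\xi\in\mathrm{Aut}(KGQ)$, then its restriction $\xi|_N$ to $N$ lies in $\complement_N(Z(K))$ if and only if there exists $z_0\in Z(K)$ such that $\complement_G(z_0)\circ\xi$ belongs to $\mathrm{Aut}(KNGQR)\subseteq\mathrm{Aut}(KGQ)$.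
   Context: Extensions. An extension of $K$ by $Q$ is a triple $(G,i,\pi)$ with $i:K\to G$ an injective homomorphism, $\pi:G\to Q$ a surjective homomorphism, $i(K)=\mathrm{Ker}(\pi)$; $K$ is identified with $i(K)$, and $P$ with $\bar\jmath(P)\subseteq Q$. Conjugation of $G$ on $K$ induces a homomorphism $Q\to\mathrm{Out}(K)=\mathrm{Aut}(K)/\mathrm{Inn}(K)$, the outer action of the extension. The $P$-subextension of $(G,i,\pi)$ is the extension $(N,i_0,\pi_0)$ of $K$ by $P$ with $N:=\pi^{-1}(P)$ and $i_0,\pi_0$ induced by $i,\pi$. With $j:N\to G$ the inclusion, $(G,j,\pi)$ is an iterated extension of $(KNP)$ by $(PQR)$, i.e. $\pi\circ j=\bar\jmath\circ\pi_0$, $j(N)=\mathrm{Ker}(\bar\phi\circ\pi)$, $(j\circ i_0)(K)=\mathrm{Ker}(\pi)$. Mod-$K$ outer actions. For a group $M$ containing $K$ as a normal subgroup, $\complement_M(m)$ is the inner automorphism $x\mapsto mxm^{-1}$, $\complement_M(S)=\{\complement_M(s):s\in S\}$, $\mathrm{Aut}_K(M)$ is the group of automorphisms of $M$ mapping $K$ onto $K$, and $\mathrm{Out}(M;K):=\mathrm{Aut}_K(M)/\complement_M(K)$. The mod-$K$ outer action of $(G,j,\pi)$ is the homomorphism $\Theta:Q\to\mathrm{Out}(N;K)$ sending $\pi(g)$ to the class of conjugation by $g\in G$ on $N$. Automorphisms. $\mathrm{Aut}(KGQ):=\{\xi\in\mathrm{Aut}(G):\xi\circ i=i,\ \pi\circ\xi=\pi\}$,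 $\mathrm{Aut}(KNP)$ is defined likewise, and $\mathrm{Aut}(KNGQR):=\{\xi\in\mathrm{Aut}(G):\xi\circ j=j,\ \pi\circ\xi=\pi\}$. $\mathrm{Out}(KGQ;K)$ is the image of $\mathrm{Aut}(KGQ)$ in $\mathrm{Out}(G;K)$. With $\mathrm{Aut}_{N,K}(G)$ the group of automorphisms of $G$ stabilizing both $N$ and $K$ and $\mathrm{Out}_N(G;K):=\mathrm{Aut}_{N,K}(G)/\complement_G(K)$, $\mathrm{Out}(KNGQR;K)$ is the image of $\mathrm{Aut}(KNGQR)$ in $\mathrm{Out}_N(G;K)$; it is a subgroup of $\mathrm{Out}(KGQ;K)$ through the inclusion $\mathrm{Aut}(KNGQR)\subseteq\mathrm{Aut}(KGQ)$. For $\xi\in\mathrm{Aut}(KGQ)$, $\xi|_N\in\mathrm{Aut}(KNP)$ is characterized by $j\circ\xi|_N=\xi\circ j$. An automorphism $\eta\in\mathrm{Aut}_K(N)$ is $\Theta$-compatible if its image in $\mathrm{Out}(N;K)$ commutes with $\Theta(q)$ for all $q\in Q$; $\mathrm{Out}_\Theta(KNP;K)$ is the image in $\mathrm{Out}(N;K)$ of the group $\mathrm{Aut}_\Theta(KNP)$ of $\Theta$-compatible elements of $\mathrm{Aut}(KNP)$. The map $\xi\mapsto\xi|_N$ takes $\mathrm{Aut}(KGQ)$ into $\mathrm{Aut}_\Theta(KNP)$. *)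

(* Defs.v *)
From HB Require Import structures.
From mathcomp Require Import all_boot.
From mathcomp Require Import generic_quotient boolp classical_sets.

Set Implicit Arguments.
Unset Strict Implicit.
Unset Printing Implicit Defensive.

Local Open Scope group_scope.
Local Open Scope quotient_scope.

(* Groups are arbitrary (possibly infinite) [groupType]s, homomorphisms are
   [{multiplicative G -> H}] and subgroups are [groupClosed G]. *)

Section Subgroups.
Variable G : groupType.

Definition mem_of_set (S : set G) : {pred G} := fun x => `[< S x >].

Lemma set_group_closed (S : set G) :
  S 1 -> (forall x y, S x -> S y -> S (x / y)) -> group_closed (mem_of_set S).
Proof.
move=> S1 SF; split; first exact/asboolP.
by move=> x y /asboolP Sx /asboolP Sy; apply/asboolP; apply: SF.
Qed.

Definition mk_subgroup (S : set G) (S1 : S 1)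
    (SF : forall x y, S x -> S y -> S (x / y)) : groupClosed G :=
  let S_closed := set_group_closed S1 SF in
  let S_V := isInvClosed.Build G _ (group_closedV S_closed) in
  let S_1 := isMul1Closed.Build G _ S_closed.1 in
  let S_M := isMulClosed.Build G _ (group_closedM S_closed) in
  HB.pack_for (groupClosed G) (mem_of_set S) S_V S_1 S_M.

Lemma in_mk_subgroup S S1 SF x : reflect (S x) (x \in @mk_subgroup S S1 SF).
Proof. exact: asboolP. Qed.

Definition subg (H : groupClosed G) : Type := {x : G | x \in H}.

Definition Subg (H : groupClosed G) x (Hx : x \in H) : subg H := exist _ x Hx.

Lemma groupClosed_closed (H : groupClosed G) : group_closed [pred x | x \in H].
Proof. by split; [apply: gpred1|move=> x y Hx Hy; apply: gpredF]. Qed.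

HB.instance Definition _ (H : groupClosed G) := SubChoice.on (subg H).
HB.instance Definition _ (H : groupClosed G) :=
  SubChoice_isSubGroup.Build G [pred x | x \in H] (subg H) (groupClosed_closed H).

Definition full_group : groupClosed G :=
  @mk_subgroup setT I (fun _ _ _ _ => I).

Definition center_set : set G := [set z | forall x, z * x = x * z].

Lemma center1 : center_set 1.
Proof. by move=> x; rewrite mul1g mulg1. Qed.

Lemma centerF x y : center_set x -> center_set y -> center_set (x / y).
Proof.
rewrite /center_set /= => cx cy z.
have cyV : y^-1 * z = z * y^-1 by apply/esym/commuteV/esym/cy.
by rewrite -mulgA cyV mulgA (cx z) -mulgA.
Qed.

Definition center : groupClosed G := mk_subgroup center1 centerF.

Section Normaliser.
Variable H : groupClosed G.

Definition normaliser_set : set G :=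
  [set x | forall h, (h ^ x \in H) = (h \in H)].

Lemma normaliser1 : normaliser_set 1.
Proof. by move=> h; rewrite conjg1. Qed.

Lemma normaliserF x y :
  normaliser_set x -> normaliser_set y -> normaliser_set (x / y).
Proof. by move=> nx ny h; rewrite conjgM -[LHS]ny -conjgM mulVg conjg1 nx. Qed.

Definition normaliser : groupClosed G := mk_subgroup normaliser1 normaliserF.

End Normaliser.
End Subgroups.

Section Morphisms.
Variables (G H : groupType) (f : {multiplicative G -> H}).

Lemma morph1 : f 1 = 1.
Proof. by apply: (@mulgI _ (f 1)); rewrite -gmulfM !mulg1. Qed.

Lemma morphV x : f x^-1 = (f x)^-1.
Proof. by apply/esym/mulg1_eq; rewrite -gmulfM mulgV morph1. Qed.

Definition kerg_set : set G := [set x | f x = 1].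

Lemma kerg1 : kerg_set 1. Proof. exact: morph1. Qed.

Lemma kergF x y : kerg_set x -> kerg_set y -> kerg_set (x / y).
Proof. by move=> /= fx fy; rewrite /kerg_set /= gmulfM morphV fx fy mulgV. Qed.

Definition kerg : groupClosed G := mk_subgroup kerg1 kergF.

Section Image.
Variable A : groupClosed G.

Definition imageg_set : set H := [set y | exists2 x, x \in A & f x = y].

Lemma imageg1 : imageg_set 1.
Proof. by exists 1; [apply: gpred1|apply: morph1]. Qed.

Lemma imagegF x y : imageg_set x -> imageg_set y -> imageg_set (x / y).
Proof.
move=> [a Aa <-] [b Ab <-]; exists (a / b); first exact: gpredF.
by rewrite gmulfM morphV.
Qed.

Definition imageg : groupClosed H := mk_subgroup imageg1 imagegF.
End Image.

Definition rangeg : groupClosed H := imageg (full_group G).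

Section Preimage.
Variable B : groupClosed H.

Definition preimg_set : set G := [set x | f x \in B].

Lemma preimg1 : preimg_set 1.
Proof. by rewrite /preimg_set /= morph1 gpred1. Qed.

Lemma preimgF x y : preimg_set x -> preimg_set y -> preimg_set (x / y).
Proof. by rewrite /preimg_set /= gmulfM morphV => *; apply: gpredF. Qed.

Definition preimg : groupClosed G := mk_subgroup preimg1 preimgF.
End Preimage.

Lemma kergP x : reflect (f x = 1) (x \in kerg).
Proof. exact: in_mk_subgroup. Qed.

Lemma imagegP (A : groupClosed G) y :
  reflect (exists2 x, x \in A & f x = y) (y \in imageg A).
Proof. exact: in_mk_subgroup. Qed.

Lemma rangegP y : reflect (exists x, f x = y) (y \in rangeg).
Proof.
apply: (iffP (imagegP _ _)) => [[x _ <-]|[x <-]]; first by exists x.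
by exists x => //; apply/in_mk_subgroup.
Qed.

Lemma preimgP (B : groupClosed H) x : reflect (f x \in B) (x \in preimg B).
Proof. exact: in_mk_subgroup. Qed.

End Morphisms.

(* As for [coset_of] on finite groups, [coset_of H] is the group N(H)/H, and
   [coset H] is the projection onto it, trivial outside N(H); for D a subgroup
   normalising H, [quotientg H D] is D/H. In particular, for several such D,
   the quotients D/H all are subgroups of one group. *)
Section Quotient.
Variables (G : groupType) (H : groupClosed G).
Local Notation N := (subg (normaliser H)).

Lemma normaliserP x :
  reflect (forall h, (h ^ x \in H) = (h \in H)) (x \in normaliser H).
Proof. exact: in_mk_subgroup. Qed.

Definition coset_equiv (x y : N) : bool := val (x^-1 * y) \in H.

Lemma coset_equivE x y : coset_equiv x y = ((val x)^-1 * val y \in H).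
Proof. by rewrite /coset_equiv. Qed.

Lemma coset_equiv_is_equiv : equiv_class_of coset_equiv.
Proof.
split=> [x|x y|y x z]; rewrite !coset_equivE.
- by rewrite mulVg gpred1.
- by rewrite -gpredV invgM invgK.
- by move=> xy yz; move: (gpredM _ _ xy yz); rewrite mulgA mulgK.
Qed.

Canonical coset_equiv_equiv := EquivRelPack coset_equiv_is_equiv.
Canonical coset_equiv_encModRel := defaultEncModRel coset_equiv.

Definition coset_of : Type := {eq_quot coset_equiv}.
HB.instance Definition _ : EqQuotient N coset_equiv coset_of :=
  EqQuotient.on coset_of.
HB.instance Definition _ := Choice.on coset_of.

Let coset_pi_eq (x y : N) :
  (\pi_coset_of x == \pi_coset_of y) = ((val x)^-1 * val y \in H).
Proof. by rewrite piE /= coset_equivE. Qed.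

Let coset_piP (x y : N) :
  \pi_coset_of x = \pi_coset_of y <-> (val x)^-1 * val y \in H.
Proof. by rewrite -coset_pi_eq; split=> /eqP. Qed.

Let normJ (x : N) h : (h ^ val x \in H) = (h \in H).
Proof. by have /normaliserP := valP x. Qed.

Let normJV (x : N) h : (h ^ (val x)^-1 \in H) = (h \in H).
Proof. by rewrite -[LHS](normJ x) -conjgM mulVg conjg1. Qed.

Definition coset_one : coset_of := \pi_coset_of (1 : N).
Definition coset_mul : coset_of -> coset_of -> coset_of :=
  fun a b => \pi_coset_of (repr a * repr b).
Definition coset_inv : coset_of -> coset_of := fun a => \pi_coset_of (repr a)^-1.

Let repr_pi (x : N) : (val x)^-1 * val (repr (\pi_coset_of x)) \in H.
Proof. by apply/coset_piP; rewrite reprK. Qed.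

Lemma coset_mul_pi (x y : N) :
  coset_mul (\pi_coset_of x) (\pi_coset_of y) = \pi_coset_of (x * y).
Proof.
apply/esym/coset_piP; rewrite !valM invgM.
set x' := repr _; set y' := repr _.
have -> : (val y)^-1 * (val x)^-1 * (val x' * val y')
   = ((val x)^-1 * val x') ^ val y * ((val y)^-1 * val y').
  by rewrite conjgE !mulgA mulgK.
by apply: gpredM; rewrite ?normJ; apply: repr_pi.
Qed.

Lemma coset_inv_pi (x : N) : coset_inv (\pi_coset_of x) = \pi_coset_of x^-1.
Proof.
have subgV (y : N) : val y^-1 = (val y)^-1 by apply: (@gmulfV _ _ (val : N -> G)).
apply/coset_piP; rewrite !subgV invgK; set x' := repr _.
have -> : val x' * (val x)^-1 = ((val x)^-1 * val x') ^ (val x)^-1.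
  by rewrite conjgE invgK !mulgA mulgV mul1g.
by rewrite normJV; apply: repr_pi.
Qed.

Lemma coset_mulA : associative coset_mul.
Proof.
elim/quotW=> x; elim/quotW=> y; elim/quotW=> z; rewrite (coset_mul_pi y z) (coset_mul_pi x (y * z)).
by rewrite (coset_mul_pi x y) (coset_mul_pi (x * y) z) mulgA.
Qed.
Lemma coset_mul1 : left_id coset_one coset_mul.
Proof. by elim/quotW=> x; rewrite coset_mul_pi mul1g. Qed.
Lemma coset_1mul : right_id coset_one coset_mul.
Proof. by elim/quotW=> x; rewrite coset_mul_pi mulg1. Qed.
Lemma coset_mulV : left_inverse coset_one coset_inv coset_mul.
Proof. by elim/quotW=> x; rewrite coset_inv_pi coset_mul_pi mulVg. Qed.
Lemma coset_Vmul : right_inverse coset_one coset_inv coset_mul.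
Proof. by elim/quotW=> x; rewrite coset_inv_pi coset_mul_pi mulgV. Qed.

HB.instance Definition _ := isGroup.Build coset_of
  coset_mulA coset_mul1 coset_1mul coset_mulV coset_Vmul.

Definition coset (x : G) : coset_of := \pi_coset_of (insubd (1 : N) x).

Lemma cosetM x y : x \in normaliser H -> y \in normaliser H ->
  coset (x * y) = coset x * coset y.
Proof.
move=> Nx Ny; rewrite /coset -[RHS]/(coset_mul _ _) coset_mul_pi; congr (\pi_coset_of _).
by apply: val_inj; rewrite valM !insubdK //; apply: gpredM.
Qed.

Lemma coset_eq x y : x \in normaliser H -> y \in normaliser H ->
  coset x = coset y <-> x^-1 * y \in H.
Proof. by move=> Nx Ny; rewrite /coset coset_piP !insubdK. Qed.

Lemma coset1 : coset 1 = 1.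
Proof.
by congr (\pi_coset_of _); apply: val_inj; rewrite insubdK //; apply: gpred1.
Qed.

Lemma cosetV x : x \in normaliser H -> coset x^-1 = (coset x)^-1.
Proof.
move=> Nx; apply/esym/mulg1_eq; rewrite -cosetM ?mulgV ?coset1 //.
by rewrite gpredV.
Qed.

Lemma normaliser_sub x : x \in H -> x \in normaliser H.
Proof.
move=> Hx; apply/normaliserP=> h.
by rewrite conjgE gpredMl ?gpredV // gpredMr.
Qed.

Lemma coset_eq1 x : x \in normaliser H -> coset x = 1 <-> x \in H.
Proof.
by move=> Nx; rewrite -coset1 coset_eq ?gpred1 // mulg1 gpredV.
Qed.

Section Sub.
Variable D : groupClosed G.

Definition quotientg_set : set coset_of :=
  [set c | exists x, [/\ x \in D, x \in normaliser H & c = coset x]].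

Lemma quotientg1 : quotientg_set 1.
Proof. by exists 1; rewrite !gpred1 coset1. Qed.

Lemma quotientgF a b : quotientg_set a -> quotientg_set b -> quotientg_set (a / b).
Proof.
move=> [x [Dx Nx ->]] [y [Dy Ny ->]]; exists (x / y).
by rewrite !gpredF // cosetM ?cosetV ?gpredV.
Qed.

Definition quotientg : groupClosed coset_of := mk_subgroup quotientg1 quotientgF.
End Sub.

Lemma quotientgP (D : groupClosed G) c :
  reflect (exists x, [/\ x \in D, x \in normaliser H & c = coset x])
    (c \in quotientg D).
Proof. exact: in_mk_subgroup. Qed.

End Quotient.

Section Automorphisms.
Variable M : groupType.

Definition is_aut (f : M -> M) : bool :=
  `[< {morph f : x y / x * y} /\ bijective f >].

Definition aut : Type := {f : M -> M | is_aut f}.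
HB.instance Definition _ := SubChoice.on aut.

Definition aut_fun (f : aut) : M -> M := val f.
Coercion aut_fun : aut >-> Funclass.

Lemma aut_morph (f : aut) : {morph f : x y / x * y}.
Proof. by have /asboolP[] := valP f. Qed.
HB.instance Definition _ (f : aut) :=
  isMultiplicative.Build M M (aut_fun f) (aut_morph f).

Lemma aut_bij (f : aut) : bijective f.
Proof. by have /asboolP[] := valP f. Qed.

Definition Aut_of (f : M -> M) (fM : {morph f : x y / x * y})
    (f_bij : bijective f) : aut :=
  Sub f (asboolT (conj fM f_bij)).

Lemma autP (f g : aut) : f =1 g -> f = g.
Proof. by move=> fg; apply/val_inj/funext. Qed.

Lemma aut_surj (f : aut) y : exists x, f x = y.
Proof. by have [g _ gK] := aut_bij f; exists (g y). Qed.

Definition aut_one : aut :=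
  @Aut_of idfun (fun _ _ => erefl) (Bijective (fun=> erefl) (fun=> erefl)).

Lemma aut_mul_morph (f g : aut) : {morph f \o g : x y / x * y}.
Proof. by move=> x y /=; rewrite !gmulfM. Qed.
Definition aut_mul (f g : aut) : aut :=
  Aut_of (@aut_mul_morph f g) (bij_comp (aut_bij f) (aut_bij g)).

Definition aut_inv_fun (f : aut) (y : M) : M := xget 1 [set x | f x = y].

Lemma aut_inv_funK (f : aut) : cancel (aut_inv_fun f) f.
Proof. by move=> y; apply: (@xgetPex _ 1 [set x | f x = y]); apply: aut_surj. Qed.
Lemma aut_fun_invK (f : aut) : cancel f (aut_inv_fun f).
Proof. by move=> x; apply: (bij_inj (aut_bij f)); rewrite aut_inv_funK. Qed.
Lemma aut_inv_morph (f : aut) : {morph aut_inv_fun f : x y / x * y}.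
Proof. exact: can2_gmulfM (@aut_fun_invK f) (@aut_inv_funK f). Qed.
Definition aut_inv (f : aut) : aut :=
  Aut_of (@aut_inv_morph f) (Bijective (@aut_inv_funK f) (@aut_fun_invK f)).

Lemma aut_mulA : associative aut_mul.
Proof. by move=> f g h; apply: autP. Qed.
Lemma aut_mul1 : left_id aut_one aut_mul.
Proof. by move=> f; apply: autP. Qed.
Lemma aut_1mul : right_id aut_one aut_mul.
Proof. by move=> f; apply: autP. Qed.
Lemma aut_mulV : left_inverse aut_one aut_inv aut_mul.
Proof. by move=> f; apply: autP => x; apply: aut_fun_invK. Qed.
Lemma aut_Vmul : right_inverse aut_one aut_inv aut_mul.
Proof. by move=> f; apply: autP => x; apply: aut_inv_funK. Qed.

HB.instance Definition _ := isGroup.Build aut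
  aut_mulA aut_mul1 aut_1mul aut_mulV aut_Vmul.

Lemma autM (f g : aut) x : (f * g : aut) x = f (g x). Proof. by []. Qed.
Lemma aut1 x : (1 : aut) x = x. Proof. by []. Qed.
Lemma autK (f : aut) : cancel f (f^-1 : aut). Proof. exact: aut_fun_invK. Qed.
Lemma autKV (f : aut) : cancel (f^-1 : aut) f. Proof. exact: aut_inv_funK. Qed.

Lemma autV (f : aut) x : f x^-1 = (f x)^-1.
Proof. exact: morphV. Qed.

Lemma conj_aut_morph (m : M) : {morph (fun x => m * x * m^-1) : x y / x * y}.
Proof. by move=> x y /=; rewrite !mulgA mulgVK. Qed.
Lemma conj_aut_bij (m : M) : bijective (fun x => m * x * m^-1).
Proof.
by exists (fun x => m^-1 * x * m) => x; rewrite !mulgA ?(mulVg, mulgV) mul1g ?mulgK ?mulgVK.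
Qed.

Definition conj_aut (m : M) : aut := Aut_of (@conj_aut_morph m) (conj_aut_bij m).

Lemma conj_autE m x : conj_aut m x = m * x * m^-1. Proof. by []. Qed.

Lemma conj_autM : {morph conj_aut : m n / m * n}.
Proof. by move=> m n; apply: autP => x; rewrite autM !conj_autE invgM !mulgA. Qed.

HB.instance Definition _ := isMultiplicative.Build M aut conj_aut conj_autM.

Definition inn (S : groupClosed M) : groupClosed aut := imageg conj_aut S.

Section Stabiliser.
Variable S : groupClosed M.

Definition aut_stab_set : set aut := [set f | imageg f S =i S].

Lemma aut_stab_setP (f : aut) : aut_stab_set f <-> forall x, (f x \in S) = (x \in S).
Proof.
split=> fS x.
  apply/idP/idP=> [|Sx]; last by rewrite -fS; apply/imagegP; exists x.
  by rewrite -fS => /imagegP[y Sy /(bij_inj (aut_bij f)) <-].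
apply/idP/idP=> [/imagegP[y Sy <-]|Sx]; first by rewrite fS.
apply/imagegP; exists ((f^-1 : aut) x); last exact: autKV.
by have := fS ((f^-1 : aut) x); rewrite autKV Sx => /esym.
Qed.

Lemma aut_stab1 : aut_stab_set 1.
Proof. exact/aut_stab_setP. Qed.

Lemma aut_stabF f g : aut_stab_set f -> aut_stab_set g -> aut_stab_set (f / g).
Proof.
move=> /aut_stab_setP fS /aut_stab_setP gS; apply/aut_stab_setP => x.
by rewrite autM fS; have := gS ((g^-1 : aut) x); rewrite autKV => /esym.
Qed.

Definition aut_stab : groupClosed aut := mk_subgroup aut_stab1 aut_stabF.

Lemma aut_stabP (f : aut) :
  reflect (forall x, (f x \in S) = (x \in S)) (f \in aut_stab).
Proof. by apply: (iffP (in_mk_subgroup _ _ _)) => /aut_stab_setP. Qed.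

Lemma conj_autJ (f : aut) m : conj_aut m ^ f = conj_aut ((f^-1 : aut) m).
Proof.
apply: autP => x; rewrite conjgE !autM !conj_autE !aut_morph.
by rewrite autV autK.
Qed.

Lemma aut_stab_norm (f : aut) : f \in aut_stab -> f \in normaliser (inn S).
Proof.
move=> /aut_stabP fS; apply/normaliserP => h; apply/idP/idP.
  move=> /imagegP[m Sm hf]; apply/imagegP; exists (f m); first by rewrite fS.
  by rewrite -[h](conjgK f) -hf conj_autJ invgK.
move=> /imagegP[m Sm <-]; rewrite conj_autJ; apply/imagegP.
exists ((f^-1 : aut) m) => //.
by have := fS ((f^-1 : aut) m); rewrite autKV Sm => /esym.
Qed.

(* Out(M;S) = Aut_S(M) / inn S. *)
Definition outer : groupClosed (coset_of (inn S)) := quotientg (inn S) aut_stab.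

End Stabiliser.

Definition Inn : groupClosed aut := inn (full_group M).

(* Inn(M) being normal in Aut(M), [coset_of Inn] is Aut(M)/Inn(M). *)
Definition Out : groupType := coset_of Inn.

Lemma norm_Inn (f : aut) : f \in normaliser Inn.
Proof.
have fT (x : M) : x \in full_group M by apply/in_mk_subgroup.
by apply: aut_stab_norm; apply/aut_stabP => x; rewrite !fT.
Qed.

End Automorphisms.

(* The automorphism of N characterised by j \o restr j f = f \o j, if any
   (1 otherwise), for j injective. *)
Definition restr (N G : groupType) (j : {multiplicative N -> G}) (f : aut G) :
    aut N :=
  xget 1 [set h : aut N | j \o h =1 f \o j].

Section Restr.
Variables (N G : groupType) (j : {multiplicative N -> G}).
Hypothesis j_inj : injective j.

Lemma restr_uniq (f : aut G) (h : aut N) : j \o h =1 f \o j -> restr j f = h.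
Proof.
move=> hf; apply: xget_unique => // h' h'f; apply: autP => x; apply: j_inj.
by rewrite [LHS]h'f [RHS]hf.
Qed.

Lemma restrE (f : aut G) : f \in aut_stab (rangeg j) -> j \o restr j f =1 f \o j.
Proof.
move=> /aut_stabP fS; apply: (@xgetPex _ 1 [set h : aut N | j \o h =1 f \o j]).
have ex x : exists y, j y = f (j x) by apply/rangegP; rewrite fS; apply/rangegP; exists x.
have [h hE] := choice ex.
have hM : {morph h : x y / x * y}.
  by move=> x y; apply: j_inj; rewrite hE !gmulfM !hE.
have h_inj : injective h.
  move=> x y /(congr1 j); rewrite !hE => /(bij_inj (aut_bij f)); exact: j_inj.
have ex' y : exists x, h x = y.
  have [z zE] : exists z, j z = (f^-1 : aut _) (j y).
    by apply/rangegP; rewrite -fS autKV; apply/rangegP; exists y.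
  by exists z; apply: j_inj; rewrite hE zE autKV.
have [k kE] := choice ex'.
by exists (Aut_of hM (Bijective (fun x => h_inj _ _ (kE (h x))) kE)).
Qed.

Lemma restrM (f g : aut G) : f \in aut_stab (rangeg j) -> g \in aut_stab (rangeg j) ->
  restr j (f * g) = restr j f * restr j g.
Proof.
move=> fS gS; apply: restr_uniq => x /=.
by rewrite !autM [LHS](restrE fS) /= [j (restr j g x)](restrE gS).
Qed.

End Restr.

(* For j : N -> G injective with normal image, S a subgroup of N, and
   pi : G -> Q surjective with kernel j(S), the homomorphism Q -> Out(N;S)
   sending pi(g) to the class of the conjugation by g on N. *)
Section ConjugationAction.
Variables (N G Q : groupType) (j : {multiplicative N -> G}).
Variables (pi : {multiplicative G -> Q}) (S : groupClosed N).
Hypothesis j_inj : injective j.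
Hypothesis pi_surj : forall q, exists g, pi g = q.
Hypothesis j_normal : forall g, conj_aut g \in aut_stab (rangeg j).
Hypothesis kerE : imageg j S =i kerg pi.

Definition conj_class (q : Q) : coset_of (inn S) :=
  coset _ (restr j (conj_aut (xget 1 [set g | pi g = q]))).

Let conj_restr g n : j (restr j (conj_aut g) n) = g * j n * g^-1.
Proof. exact: restrE. Qed.

Let ker_conj g x : (g * x * g^-1 \in kerg pi) = (x \in kerg pi).
Proof.
apply/idP/idP=> /kergP pix; apply/kergP; last first.
  by rewrite !gmulfM pix mulg1 -gmulfM mulgV morph1.
have -> : x = g^-1 * (g * x * g^-1) * g by rewrite !mulgA mulVg mul1g mulgVK.
by rewrite gmulfM gmulfM pix mulg1 -gmulfM mulVg morph1.
Qed.

Let in_S n : (n \in S) = (j n \in kerg pi).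
Proof.
rewrite -kerE; apply/idP/imagegP=> [Sn|[m Sm /j_inj <-] //]; by exists n.
Qed.

Lemma restr_conj_stab g : restr j (conj_aut g) \in aut_stab S.
Proof. by apply/aut_stabP => n; rewrite !in_S conj_restr ker_conj. Qed.

Lemma conj_classE g : conj_class (pi g) = coset _ (restr j (conj_aut g)).
Proof.
rewrite /conj_class; set g' := xget _ _.
have piE : pi g' = pi g by apply: (@xgetPex _ 1 [set x | pi x = pi g]); exists g.
apply/coset_eq; try by apply/aut_stab_norm/restr_conj_stab.
have : g'^-1 * g \in kerg pi by apply/kergP; rewrite gmulfM morphV piE mulVg.
rewrite -kerE => /imagegP[s Ss sE]; apply/imagegP; exists s => //.
apply: (mulgI (restr j (conj_aut g'))); rewrite mulVKg //.
apply/esym/restr_uniq => // n /=; rewrite conj_restr conj_autE !gmulfM morphV sE.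
by rewrite invgM invgK !mulgA mulgV mul1g mulgK.
Qed.

Lemma conj_class_outer q : conj_class q \in outer S.
Proof.
have [g <-] := pi_surj q; apply/quotientgP.
exists (restr j (conj_aut g)); rewrite conj_classE; split=> //.
  exact: restr_conj_stab.
exact/aut_stab_norm/restr_conj_stab.
Qed.

Lemma conj_classM : {morph conj_class : q r / q * r}.
Proof.
move=> q r; have [g <-] := pi_surj q; have [h <-] := pi_surj r.
rewrite -gmulfM !conj_classE conj_autM restrM // cosetM //;
  exact/aut_stab_norm/restr_conj_stab.
Qed.

Definition conj_class_sub (q : Q) : subg (outer S) := Subg (conj_class_outer q).

Lemma conj_class_subM : {morph conj_class_sub : q r / q * r}.
Proof. by move=> q r; apply: val_inj; rewrite valM /= conj_classM. Qed.

End ConjugationAction.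

Record extension (K G Q : groupType) := Extension {
  ext_i : {multiplicative K -> G};
  ext_pi : {multiplicative G -> Q};
  ext_i_inj : injective ext_i;
  ext_pi_surj : forall q, exists g, ext_pi g = q;
  ext_exact : rangeg ext_i =i kerg ext_pi
}.

Lemma ker_stab (G Q : groupType) (f : {multiplicative G -> Q}) g :
  conj_aut g \in aut_stab (kerg f).
Proof.
apply/aut_stabP => x; apply/idP/idP=> /kergP fx; apply/kergP; last first.
  by rewrite conj_autE !gmulfM fx mulg1 -gmulfM mulgV morph1.
apply: (mulgI (f g)); apply: (mulIg (f g^-1)).
by rewrite -!gmulfM -conj_autE fx mulg1 -gmulfM mulgV morph1.
Qed.

Lemma aut_stab_eq (G : groupType) (A B : groupClosed G) f :
  A =i B -> (f \in aut_stab A) -> f \in aut_stab B.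
Proof. by move=> AB /aut_stabP fA; apply/aut_stabP => x; rewrite -!AB. Qed.

Section OuterAction.
Variables (K G Q : groupType) (E : extension K G Q).

Lemma ext_normal g : conj_aut g \in aut_stab (rangeg (ext_i E)).
Proof.
exact: (aut_stab_eq (fun x => esym (ext_exact E x)) (ker_stab (ext_pi E) g)).
Qed.

Definition outer_action_fun : Q -> Out K :=
  conj_class (ext_i E) (ext_pi E) (full_group K).

Lemma outer_action_funM : {morph outer_action_fun : q r / q * r}.
Proof.
exact: (conj_classM (@ext_i_inj _ _ _ E) (ext_pi_surj E) ext_normal (ext_exact E)).
Qed.

HB.instance Definition _ :=
  isMultiplicative.Build Q (Out K) outer_action_fun outer_action_funM.

(* The outer action Q -> Out(K) of the extension; see [outer_actionE]. *)
Definition outer_action : {multiplicative Q -> Out K} := outer_action_fun.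

Lemma outer_actionE g :
  outer_action (ext_pi E g) = coset (Inn K) (restr (ext_i E) (conj_aut g)).
Proof.
exact: (conj_classE (@ext_i_inj _ _ _ E) ext_normal (ext_exact E)).
Qed.

End OuterAction.

Section ExtensionAutomorphisms.
Variables (K G Q : groupType) (E : extension K G Q).

Definition Aut_ext_set : set (aut G) :=
  [set xi : aut G | xi \o ext_i E =1 ext_i E /\ ext_pi E \o xi =1 ext_pi E].

Lemma Aut_ext1 : Aut_ext_set 1. Proof. by []. Qed.

Lemma Aut_extF (f g : aut G) : Aut_ext_set f -> Aut_ext_set g -> Aut_ext_set (f / g).
Proof.
move=> [fi fp] [gi gp]; split=> x /=; rewrite autM.
  by rewrite -[ext_i E x in LHS]gi /= autK; apply: fi.
by rewrite [LHS]fp -[LHS]gp /= autKV.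
Qed.

(* Aut(KGQ) *)
Definition Aut_ext : groupClosed (aut G) := mk_subgroup Aut_ext1 Aut_extF.

Lemma Aut_extP (xi : aut G) :
  reflect (xi \o ext_i E =1 ext_i E /\ ext_pi E \o xi =1 ext_pi E) (xi \in Aut_ext).
Proof. exact: in_mk_subgroup. Qed.

(* C_G(K), where K is identified with its image in G *)
Definition inn_K : groupClosed (aut G) := inn (rangeg (ext_i E)).

(* Out(KGQ;K) *)
Definition Out_ext : groupClosed (coset_of inn_K) := quotientg inn_K Aut_ext.

Lemma Aut_ext_stab (xi : aut G) : xi \in Aut_ext -> xi \in aut_stab (rangeg (ext_i E)).
Proof.
move=> /Aut_extP[_ xip]; apply/aut_stabP => x; rewrite !ext_exact.
by apply/kergP/kergP; rewrite -[ext_pi E (xi x)]/((ext_pi E \o xi) x) xip.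
Qed.

Lemma Aut_ext_norm (xi : aut G) : xi \in Aut_ext -> xi \in normaliser inn_K.
Proof. by move=> /Aut_ext_stab /aut_stab_norm. Qed.

End ExtensionAutomorphisms.

Record iterated_extension (K N P Q R G : groupType)
    (KNP : extension K N P) (PQR : extension P Q R) := IteratedExtension {
  iext_j : {multiplicative N -> G};
  iext_pi : {multiplicative G -> Q};
  iext_j_inj : injective iext_j;
  iext_pi_surj : forall q, exists g, iext_pi g = q;
  iext_comm : iext_pi \o iext_j =1 ext_i PQR \o ext_pi KNP;
  iext_exactN : rangeg iext_j =i kerg (ext_pi PQR \o iext_pi);
  iext_exactK : rangeg (iext_j \o ext_i KNP) =i kerg iext_pi
}.

Section IteratedExtension.
Variables (K N P Q R G : groupType).
Variables (KNP : extension K N P) (PQR : extension P Q R).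
Variable E : iterated_extension G KNP PQR.
Local Notation j := (iext_j E).
Local Notation pi := (iext_pi E).

Definition Aut_iext_set : set (aut G) := [set xi : aut G | xi \o j =1 j /\ pi \o xi =1 pi].

Lemma Aut_iext1 : Aut_iext_set 1. Proof. by []. Qed.

Lemma Aut_iextF (f g : aut G) : Aut_iext_set f -> Aut_iext_set g -> Aut_iext_set (f / g).
Proof.
move=> [fi fp] [gi gp]; split=> x /=; rewrite autM.
  by rewrite -[j x in LHS]gi /= autK; apply: fi.
by rewrite [LHS]fp -[LHS]gp /= autKV.
Qed.

(* Aut(KNGQR) *)
Definition Aut_iext : groupClosed (aut G) := mk_subgroup Aut_iext1 Aut_iextF.

Lemma Aut_iextP (xi : aut G) :
  reflect (xi \o j =1 j /\ pi \o xi =1 pi) (xi \in Aut_iext).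
Proof. exact: in_mk_subgroup. Qed.

Lemma iext_normal g : conj_aut g \in aut_stab (rangeg j).
Proof.
exact: (aut_stab_eq (fun x => esym (iext_exactN E x)) (ker_stab _ g)).
Qed.

Lemma iext_kerE : imageg j (rangeg (ext_i KNP)) =i kerg pi.
Proof.
move=> x; rewrite -iext_exactK; apply/imagegP/rangegP.
  by move=> [_ /rangegP[k <-] <-]; exists k.
by move=> [k <-]; exists (ext_i KNP k) => //; apply/rangegP; exists k.
Qed.

Definition mod_outer_action_fun : Q -> subg (outer (rangeg (ext_i KNP))) :=
  conj_class_sub (@iext_j_inj _ _ _ _ _ _ _ _ E) (iext_pi_surj E) iext_normal
    iext_kerE.

HB.instance Definition _ :=
  isMultiplicative.Build Q (subg (outer (rangeg (ext_i KNP)))) mod_outer_action_fun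
    (conj_class_subM (@iext_j_inj _ _ _ _ _ _ _ _ E) (iext_pi_surj E) iext_normal
      iext_kerE).

(* The mod-K outer action Q -> Out(N;K) of (G, j, pi); see
   [mod_outer_actionE]. *)
Definition mod_outer_action :
  {multiplicative Q -> subg (outer (rangeg (ext_i KNP)))} := mod_outer_action_fun.

Lemma mod_outer_actionE g :
  val (mod_outer_action (pi g)) = coset (inn_K KNP) (restr j (conj_aut g)).
Proof.
exact: (conj_classE (@iext_j_inj _ _ _ _ _ _ _ _ E) iext_normal iext_kerE).
Qed.

End IteratedExtension.

Section Compatible.
Variables (K N P Q : groupType) (KNP : extension K N P).
Variable Theta : {multiplicative Q -> subg (outer (rangeg (ext_i KNP)))}.

(* The class of eta in Out(N;K) commutes with all the Theta(q). *)
Definition compatible (eta : aut N) : Prop :=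
  eta \in aut_stab (rangeg (ext_i KNP)) /\
  forall q, commute (coset (inn_K KNP) eta) (val (Theta q)).

Definition Aut_Theta_set : set (aut N) :=
  [set eta : aut N | eta \in Aut_ext KNP /\ compatible eta].

Lemma Aut_Theta1 : Aut_Theta_set 1.
Proof.
split; first exact: gpred1.
by split=> [|q]; rewrite ?gpred1 // coset1; apply/commute_sym/commute1.
Qed.

Lemma Aut_ThetaF (f g : aut N) : Aut_Theta_set f -> Aut_Theta_set g -> Aut_Theta_set (f / g).
Proof.
move=> [fA [fS fT]] [gA [gS gT]]; split; first exact: gpredF.
split=> [|q]; first exact: gpredF.
rewrite cosetM ?cosetV ?gpredV ?aut_stab_norm //.
by apply/commute_sym/commuteM; [|apply: commuteV]; apply/commute_sym.
Qed.

(* Aut_Theta(KNP) *)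
Definition Aut_Theta : groupClosed (aut N) := mk_subgroup Aut_Theta1 Aut_ThetaF.

Lemma Aut_ThetaP (eta : aut N) :
  reflect (eta \in Aut_ext KNP /\ compatible eta) (eta \in Aut_Theta).
Proof. exact: in_mk_subgroup. Qed.

(* Out_Theta(KNP;K) *)
Definition Out_Theta : groupClosed (coset_of (inn_K KNP)) :=
  quotientg (inn_K KNP) Aut_Theta.

End Compatible.

Section Subextension.
Variables (K P Q R G : groupType).
Variables (PQR : extension P Q R) (KGQ : extension K G Q).
Local Notation i := (ext_i KGQ).
Local Notation pi := (ext_pi KGQ).
Local Notation jbar := (ext_i PQR).

(* N = pi^-1(P), where P is identified with its image in Q *)
Definition subext_group : groupClosed G := preimg pi (rangeg jbar).
Local Notation N := (subg subext_group).

Lemma pi_i k : pi (i k) = 1.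
Proof. by apply/kergP; rewrite -ext_exact; apply/rangegP; exists k. Qed.

Lemma subext_i_subproof k : i k \in subext_group.
Proof. by apply/preimgP; rewrite pi_i gpred1. Qed.
Definition subext_i_fun (k : K) : N := Subg (subext_i_subproof k).
Lemma subext_i_morph : {morph subext_i_fun : x y / x * y}.
Proof. by move=> x y; apply: val_inj; rewrite valM /= gmulfM. Qed.
HB.instance Definition _ := isMultiplicative.Build K N subext_i_fun subext_i_morph.

Definition subext_pi_fun (n : N) : P := xget 1 [set p | jbar p = pi (val n)].
Lemma subext_pi_funE n : jbar (subext_pi_fun n) = pi (val n).
Proof.
apply: (@xgetPex _ 1 [set p | jbar p = pi (val n)]).
by apply/rangegP/preimgP; apply: valP.
Qed.
Lemma subext_pi_morph : {morph subext_pi_fun : x y / x * y}.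
Proof.
by move=> x y; apply: (@ext_i_inj _ _ _ PQR); rewrite gmulfM !subext_pi_funE valM gmulfM.
Qed.
HB.instance Definition _ := isMultiplicative.Build N P subext_pi_fun subext_pi_morph.

Lemma subext_i_inj : injective subext_i_fun.
Proof. by move=> x y /(congr1 val)/= /(@ext_i_inj _ _ _ KGQ). Qed.

Lemma subext_pi_surj p : exists n, subext_pi_fun n = p.
Proof.
have [g gE] := ext_pi_surj KGQ (jbar p).
have Ng : g \in subext_group by apply/preimgP; rewrite gE; apply/rangegP; exists p.
by exists (Subg Ng); apply: (@ext_i_inj _ _ _ PQR); rewrite subext_pi_funE.
Qed.

Lemma subext_exact : rangeg subext_i_fun =i kerg subext_pi_fun.
Proof.
move=> n; apply/rangegP/kergP => [[k <-]|n1].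
  by apply: (@ext_i_inj _ _ _ PQR); rewrite subext_pi_funE /= pi_i morph1.
have : val n \in kerg pi by apply/kergP; rewrite -subext_pi_funE n1 morph1.
by rewrite -ext_exact => /rangegP[k kE]; exists k; apply: val_inj.
Qed.

Definition subext : extension K N P :=
  @Extension K N P subext_i_fun subext_pi_fun
    subext_i_inj subext_pi_surj subext_exact.

Lemma subext_comm : pi \o (val : N -> G) =1 jbar \o ext_pi subext.
Proof. by move=> n /=; rewrite subext_pi_funE. Qed.

Lemma subext_exactN : rangeg (val : N -> G) =i kerg (ext_pi PQR \o pi).
Proof.
move=> g; apply/rangegP/kergP => [[n <-] /=|/= g1].
  have /preimgP/rangegP[p <-] := valP n.
  by apply/kergP; rewrite -ext_exact; apply/rangegP; exists p.
have Ng : g \in subext_group by apply/preimgP; rewrite ext_exact; apply/kergP.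
by exists (Subg Ng).
Qed.

Lemma subext_exactK : rangeg ((val : N -> G) \o ext_i subext) =i kerg pi.
Proof. by move=> g; rewrite -ext_exact; apply/rangegP/rangegP. Qed.

(* The iterated extension (KNGQR) = (G, j, pi), with j : N -> G the inclusion. *)
Definition subext_iterated : iterated_extension G subext PQR :=
  @IteratedExtension K N P Q R G subext PQR (val : N -> G) pi
    val_inj (ext_pi_surj KGQ) subext_comm subext_exactN subext_exactK.

(* Out(KNGQR;K): as Out(G;K) and Out_N(G;K) both are quotients by C_G(K),
   they are subgroups of [coset_of (inn_K KGQ)], Out_N(G;K) included in
   Out(G;K), and the image of Aut(KNGQR) is the same in both. *)
Definition Out_iext : groupClosed (coset_of (inn_K KGQ)) :=
  quotientg (inn_K KGQ) (Aut_iext subext_iterated).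

Local Notation j := (iext_j subext_iterated).
Local Notation Theta := (mod_outer_action subext_iterated).

Lemma Aut_ext_stabN (xi : aut G) : xi \in Aut_ext KGQ -> xi \in aut_stab (rangeg j).
Proof.
move=> /Aut_extP[_ xip]; apply/aut_stabP => x; rewrite !subext_exactN.
by apply/kergP/kergP => /=; rewrite -[pi (xi x)]/((pi \o xi) x) xip.
Qed.

Lemma restr_valE (xi : aut G) : xi \in Aut_ext KGQ -> j \o restr j xi =1 xi \o j.
Proof. by move=> /Aut_ext_stabN; apply: restrE; apply: val_inj. Qed.

Lemma restr_Aut_ext (xi : aut G) : xi \in Aut_ext KGQ -> restr j xi \in Aut_ext subext.
Proof.
move=> xiA; have rE := restr_valE xiA; have /Aut_extP[xii xip] := xiA.
apply/Aut_extP; split=> x /=.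
  by apply: val_inj; rewrite [LHS]rE; apply: xii.
apply: (@ext_i_inj _ _ _ PQR); rewrite !subext_pi_funE.
by rewrite [val (restr _ _ _)]rE; apply: xip.
Qed.

Lemma restr_Aut_Theta (xi : aut G) : xi \in Aut_ext KGQ -> restr j xi \in Aut_Theta Theta.
Proof.
move=> xiA; have rA := restr_Aut_ext xiA; apply/Aut_ThetaP; split=> //.
split=> [|q]; first exact: Aut_ext_stab.
have [g <-] := ext_pi_surj KGQ q; rewrite (mod_outer_actionE subext_iterated).
have cN h : restr j (conj_aut h) \in normaliser (inn_K subext).
  apply/aut_stab_norm/(restr_conj_stab _ _ (@iext_kerE _ _ _ _ _ _ _ _ subext_iterated)).
    exact: val_inj.
  exact: iext_normal.
have rN := Aut_ext_norm rA.
rewrite /commute -cosetM // -cosetM //.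
have -> : restr j xi * restr j (conj_aut g)
    = restr j (conj_aut (xi g)) * restr j xi.
  have xiN := Aut_ext_stabN xiA; have cS := iext_normal subext_iterated.
  rewrite -!restrM //; try exact: val_inj.
  congr restr; apply: autP => x; rewrite !autM !conj_autE !aut_morph.
  by rewrite autV.
rewrite !cosetM //; congr (_ * _).
have := mod_outer_actionE subext_iterated; move=> E.
rewrite -[LHS]E -[RHS]E; congr (val (Theta _)).
by have /Aut_extP[_] := xiA; apply.
Qed.

Definition out_restr_class (c : coset_of (inn_K KGQ)) : coset_of (inn_K subext) :=
  coset _ (restr j (xget 1 [set xi | xi \in Aut_ext KGQ /\ c = coset _ xi])).

Lemma out_restr_classE (xi : aut G) : xi \in Aut_ext KGQ ->
  out_restr_class (coset _ xi) = coset _ (restr j xi).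
Proof.
move=> xiA; rewrite /out_restr_class; set xi' := xget _ _.
have [xi'A xiE] : xi' \in Aut_ext KGQ /\ coset (inn_K KGQ) xi = coset _ xi'.
  apply: (@xgetPex _ 1 [set x | x \in Aut_ext KGQ /\ coset (inn_K KGQ) xi = coset _ x]).
  by exists xi.
apply/coset_eq; try exact/Aut_ext_norm/restr_Aut_ext.
move/esym/coset_eq: xiE => /(_ (Aut_ext_norm xi'A) (Aut_ext_norm xiA)).
move=> /imagegP[_ /rangegP[k <-] kE].
apply/imagegP; exists (ext_i subext k); first by apply/rangegP; exists k.
apply: (mulgI (restr j xi')); rewrite mulVKg.
transitivity (restr j xi' * restr j (conj_aut (i k))).
  by congr (_ * _); apply/esym/restr_uniq; [apply: val_inj|].
have xiN := Aut_ext_stabN xi'A; have cS := iext_normal subext_iterated.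
rewrite -restrM //; last exact: val_inj.
by rewrite kE mulVKg.
Qed.

Lemma out_restr_subproof (c : subg (Out_ext KGQ)) :
  out_restr_class (val c) \in Out_Theta Theta.
Proof.
have /quotientgP[xi [xiA _ ->]] := valP c.
rewrite out_restr_classE //; apply/quotientgP; exists (restr j xi); split=> //.
  exact: restr_Aut_Theta.
exact/Aut_ext_norm/restr_Aut_ext.
Qed.

Definition out_restr_fun (c : subg (Out_ext KGQ)) : subg (Out_Theta Theta) :=
  Subg (out_restr_subproof c).

Lemma out_restr_funM : {morph out_restr_fun : c d / c * d}.
Proof.
move=> c d; apply: val_inj; rewrite [RHS]valM.
rewrite -[LHS]/(out_restr_class (val (c * d))) valM.
rewrite -[RHS]/(out_restr_class (val c) * out_restr_class (val d)).
have /quotientgP[xi [xiA xiN ->]] := valP c.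
have /quotientgP[yi [yiA yiN ->]] := valP d.
rewrite -cosetM // !out_restr_classE ?gpredM //.
rewrite restrM ?Aut_ext_stabN //; last exact: val_inj.
by rewrite cosetM //; apply/Aut_ext_norm/restr_Aut_ext.
Qed.

HB.instance Definition _ :=
  isMultiplicative.Build (subg (Out_ext KGQ)) (subg (Out_Theta Theta))
    out_restr_fun out_restr_funM.

(* The homomorphism Out(KGQ;K) -> Out_Theta(KNP;K) induced by restriction
   to N; see [out_restrE]. *)
Definition out_restr :
  {multiplicative subg (Out_ext KGQ) -> subg (Out_Theta Theta)} := out_restr_fun.

Lemma out_restrE (c : subg (Out_ext KGQ)) (xi : aut G) :
  xi \in Aut_ext KGQ -> val c = coset _ xi ->
  val (out_restr c) = coset _ (restr j xi).
Proof. by move=> xiA /= ->; apply: out_restr_classE. Qed.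

End Subextension.

(* Main.v *)
Require Import Defs.
From HB Require Import structures.
From mathcomp Require Import all_boot.

Local Open Scope group_scope.

(** Restriction to N is a homomorphism Aut(KGQ) -> Aut(KNP), and Aut(KNGQR) is
    its kernel ([Aut_iext_restr]): compatibility with pi is common to both
    groups, so only the condition of being the identity on N is left.  It
    carries conjugation by an element k of K on G to conjugation by k on N
    ([restr_conj_i]).  Hence the restriction of xi is conjugation by an element
    of Z(K) exactly when xi can be corrected by such a conjugation into the
    kernel; Z(K) is the right set of corrections because conjugation by a
    central element of K stays in Aut(KGQ).

    For the statement on outer classes, the class of xi dies in Out(KNP;K) when
    its restriction to N is conjugation by some k in K.  The restriction being
    the identity on K, such a k is automatically central
    ([Aut_ext_inn_center]), so that the previous equivalence applies, and the
    correction does not change the class of xi modulo the conjugations by K. *)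

Lemma centerP (G : groupType) (z : G) :
  reflect (forall x, z * x = x * z) (z \in center G).
Proof. exact: in_mk_subgroup. Qed.

Section Extension.
Variables (K G Q : groupType) (E : extension K G Q).
Local Notation i := (ext_i E).

(** The conjugations by K that fix K pointwise are those by Z(K), whether or
    not the conjugating element was chosen central: injectivity of i brings
    the commutation back from G to K. *)
Lemma Aut_ext_inn_center (xi : aut G) : xi \in Aut_ext E ->
  (xi \in inn_K E) = (xi \in inn (imageg i (center K))).
Proof.
move=> /Aut_extP[xii _]; apply/imagegP/imagegP => -[_ /imagegP[k Zk <-] kE].
- exists (i k) => //; apply/imagegP; exists k => //.
  apply/centerP => x; apply: (@ext_i_inj _ _ _ E); rewrite !gmulfM.
  have /= := xii x; rewrite -kE conj_autE => {2}<-.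
  by rewrite mulgVK.
- by exists (i k) => //; apply/rangegP; exists k.
Qed.

Lemma conj_center_Aut_ext z : z \in center K -> conj_aut (i z) \in Aut_ext E.
Proof.
move=> /centerP zC; apply/Aut_extP; split=> x /=.
  by rewrite conj_autE -gmulfM zC gmulfM mulgK.
by rewrite conj_autE !gmulfM morphV pi_i mul1g invg1 mulg1.
Qed.

Lemma coset_conj_i k (xi : aut G) : xi \in Aut_ext E ->
  coset (inn_K E) (conj_aut (i k) * xi) = coset (inn_K E) xi.
Proof.
move=> /Aut_ext_norm xiN.
have kI : conj_aut (i k) \in inn_K E.
  by apply/imagegP; exists (i k) => //; apply/rangegP; exists k.
have kN := normaliser_sub kI.
by rewrite cosetM // (coset_eq1 kN).2 // mul1g.
Qed.

End Extension.

Section Subextension.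
Variables (K P Q R G : groupType).
Variables (PQR : extension P Q R) (KGQ : extension K G Q).
Local Notation KNP := (subext PQR KGQ).
Local Notation KNGQR := (subext_iterated PQR KGQ).
Local Notation i := (ext_i KGQ).
Local Notation i0 := (ext_i KNP).
Local Notation j := (iext_j KNGQR).

Lemma Aut_iext_ext (xi : aut G) : xi \in Aut_iext KNGQR -> xi \in Aut_ext KGQ.
Proof.
move=> /Aut_iextP[xij xip]; apply/Aut_extP; split=> // k.
exact: (xij (i0 k)).
Qed.

Lemma Aut_iext_restr (xi : aut G) : xi \in Aut_ext KGQ ->
  (xi \in Aut_iext KNGQR) <-> restr j xi = 1.
Proof.
move=> xiA; split=> [/Aut_iextP[xij _]|xi1].
  by apply: restr_uniq; [exact: val_inj | move=> n; rewrite [RHS]xij].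
have /Aut_extP[_ xip] := xiA; apply/Aut_iextP; split=> // n.
by rewrite -(restr_valE xiA) /= xi1.
Qed.

Lemma restr_conj_i k : restr j (conj_aut (i k)) = conj_aut (i0 k).
Proof. by apply: restr_uniq; first exact: val_inj. Qed.

(** By multiplicativity of restriction, the correction z0 is the inverse of the
    central element by which the restriction of xi conjugates. *)
Lemma restr_inn_center (xi : aut G) : xi \in Aut_ext KGQ ->
  (restr j xi \in inn (imageg i0 (center K))) <->
  (exists2 z0 : K, z0 \in center K & conj_aut (i z0) * xi \in Aut_iext KNGQR).
Proof.
move=> xiA.
have corrE z : z \in center K ->
    (conj_aut (i z) * xi \in Aut_iext KNGQR) <->
    conj_aut (i0 z) * restr j xi = 1.
  move=> Zz; have zA := conj_center_Aut_ext _ _ _ KGQ _ Zz.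
  rewrite Aut_iext_restr ?gpredM // restrM ?Aut_ext_stabN //; last exact: val_inj.
  by rewrite restr_conj_i.
split=> [/imagegP[_ /imagegP[z Zz <-] zE]|[z Zz /(corrE z Zz) zxi1]].
  have ZzV : z^-1 \in center K by rewrite gpredV.
  exists z^-1 => //; apply/(corrE _ ZzV).
  by rewrite -zE -gmulfM -gmulfM mulVg !morph1.
apply/imagegP; exists (i0 z^-1); last by rewrite !morphV; apply: mulg1_eq.
by apply/imagegP; exists z^-1; rewrite ?gpredV.
Qed.

Lemma Out_iext_ext : {subset Out_iext PQR KGQ <= Out_ext KGQ}.
Proof.
move=> c /quotientgP[xi [xiI xiN ->]]; apply/quotientgP.
by exists xi; split=> //; apply: Aut_iext_ext.
Qed.

Lemma ker_out_restr (c : subg (Out_ext KGQ)) :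
  (c \in kerg (out_restr PQR KGQ)) = (val c \in Out_iext PQR KGQ).
Proof.
apply/kergP/quotientgP => [c1|[xi [xiI _ cE]]]; last first.
  have xiA := Aut_iext_ext _ xiI.
  apply: val_inj; rewrite (out_restrE PQR xiA cE).
  by rewrite ((Aut_iext_restr _ xiA).1 xiI) coset1.
have /quotientgP[xi [xiA _ cE]] := valP c.
have rA := restr_Aut_ext PQR xiA.
have : restr j xi \in inn_K KNP.
  by apply/(coset_eq1 (Aut_ext_norm rA)); rewrite -(out_restrE PQR xiA cE) c1.
rewrite Aut_ext_inn_center // => /(restr_inn_center _ xiA)[z _ zI].
exists (conj_aut (i z) * xi); split=> //.
  exact/Aut_ext_norm/Aut_iext_ext.
by rewrite cE coset_conj_i.
Qed.

End Subextension.

Theorem proposition8p4 (K P Q R G : groupType) (PQR : extension P Q R)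
    (theta : {multiplicative Q -> Out K}) (KGQ : extension K G Q)
    (KGQ_theta : outer_action KGQ =1 theta) :
  let KNP := subext PQR KGQ in
  let KNGQR := subext_iterated PQR KGQ in
  let i := ext_i KGQ in
  let i0 := ext_i KNP in
  let j := iext_j KNGQR in
  [/\ {subset Out_iext PQR KGQ <= Out_ext KGQ},
      forall c : subg (Out_ext KGQ),
        (c \in kerg (out_restr PQR KGQ)) = (val c \in Out_iext PQR KGQ)
    & forall xi : aut G, xi \in Aut_ext KGQ ->
        (restr j xi \in inn (imageg i0 (center K))) <->
        (exists2 z0 : K, z0 \in center K &
           conj_aut (i z0) * xi \in Aut_iext KNGQR)].
Proof.
split; [exact: Out_iext_ext | exact: ker_out_restr | exact: restr_inn_center].
Qed.
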